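(* Let $\ell\in\{\tfrac12,\tfrac32,\tfrac52,\dots\}$ and let $m\ge 0$ be an integer. The Kac determinant $\mathcal{D}^\ell_m$ of $\mathfrak{g}_\ell$ at level $m$, as a function of the highest weight $(\delta,\mu)$, is given by $$\mathcal{D}^\ell_m=C^\ell_m\,\mu^{e^\ell_m}\prod_{j=0}^{\lfloor m/2\rfloor-1}\left(2\delta-2j+\left(\ell+\tfrac12\right)^2\right)^{d^\ell_{m-2(j+1)}}$$ for some constant $C^\ell_m$ (independent of $\delta$ and $\mu$), where the numbers $d^\ell_m$ and $e^\ell_m$ are determined by the generating functions $$\sum_{m=0}^\infty d^\ell_m x^m=\frac{1}{1-x^2}\prod_{j=0}^{\ell-\frac12}\frac{1}{1-x^{2j+1}},\qquad \sum_{m=0}^\infty e^\ell_m x^m=\left(\sum_{i=0}^{\ell-\frac12}\frac{x^{2i+1}}{1-x^{2i+1}}\right)\frac{1}{1-x^2}\prod_{j=0}^{\ell-\frac12}\frac{1}{1-x^{2j+1}}.$$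
   Context: For $\ell\in\{\tfrac12,\tfrac32,\tfrac52,\dots\}$, $\mathfrak{g}_\ell$ is the complex Lie algebra (centrally extended conformal Galilei algebra) with basis $C,D,H,M,P_0,P_1,\dots,P_{2\ell}$, where $M$ is central and the other non-zero brackets are $[D,H]=2H$, $[D,C]=-2C$, $[C,H]=D$, $[H,P_n]=-nP_{n-1}$, $[D,P_n]=2(\ell-n)P_n$, $[C,P_n]=(2\ell-n)P_{n+1}$, $[P_m,P_n]=\delta_{m+n,2\ell}\,I_m M$ with $I_m=(-1)^{m+\ell+\frac12}\,m!\,(2\ell-m)!$. Triangular decomposition: $\mathfrak{g}_\ell^+=\mathrm{span}\{H,P_0,\dots,P_{\ell-\frac12}\}$, $\mathfrak{g}_\ell^0=\mathrm{span}\{D,M\}$, $\mathfrak{g}_\ell^-=\mathrm{span}\{C,P_{\ell+\frac12},\dots,P_{2\ell}\}$. For real $\delta,\mu$, the Verma module $V^{\delta,\mu}=U(\mathfrak{g}_\ell^-)|\delta,\mu\rangle$ is induced from the highest weight vector $|\delta,\mu\rangle$ with $D|\delta,\mu\rangle=\delta|\delta,\mu\rangle$, $M|\delta,\mu\rangle=\mu|\delta,\mu\rangle$, $\mathfrak{g}_\ell^+|\delta,\mu\rangle=0$. Its level-$m$ subspace $V^{\delta,\mu}_m$ has basis the vectors $C^h\prod_{j=0}^{\ell-\frac12}P_{\ell+\frac12+j}^{k_j}|\delta,\mu\rangle$ with $h,k_j\in\mathbb{Z}_{\ge0}$ and $2h+\sum_{j=0}^{\ell-\frac12}(2j+1)k_j=m$.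 The Shapovalov form $(\cdot,\cdot)$ on $V^{\delta,\mu}$ is the sesquilinear form with $(|\delta,\mu\rangle,|\delta,\mu\rangle)=1$ and $(Ax,y)=(x,\omega(A)y)$ for all $x,y\in V^{\delta,\mu}$ and all generators $A\in\{C,D,H,M,P_0,\dots,P_{2\ell}\}$, where $\omega$ is the involutive anti-automorphism with $\omega(P_j)=P_{2\ell-j}$, $\omega(C)=H$, $\omega(H)=C$, $\omega(D)=D$, $\omega(M)=M$. The Kac determinant at level $m$ is the determinant of the matrix with entries $(v_i,v_j)$, where $\{v_i\}$ is the basis of $V^{\delta,\mu}_m$ consisting of the vectors $C^h\prod_{j=0}^{\ell-\frac12}P_{\ell+\frac12+j}^{k_j}|\delta,\mu\rangle$ with $h,k_j\in\mathbb{Z}_{\ge0}$ and $2h+\sum_{j=0}^{\ell-\frac12}(2j+1)k_j=m$ (in any order). Empty products equal $1$ and $\mu^0=1$. *)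

(* Defs.v *)
From HB Require Import structures.
From mathcomp Require Import all_boot all_order all_algebra.
From mathcomp Require Import sesquilinear.
From mathcomp Require Import reals.
From mathcomp Require Import complex.
Set Implicit Arguments.
Unset Strict Implicit.
Unset Printing Implicit Defensive.
Import Order.TTheory GRing.Theory Num.Theory.
Local Open Scope ring_scope.
Local Open Scope complex_scope.

(* The half-integer ell in {1/2, 3/2, ...} is encoded by the
   natural number n with ell = n + 1/2; thus 2 ell = n.*2.+1 and
   ell - 1/2 = n, ell + 1/2 = n.+1. *)
Definition ell (R : realType) (n : nat) : R := n%:R + 2^-1.

Inductive gen (n : nat) : Type :=
  | gC | gD | gH | gM | gP of 'I_n.*2.+2.

Arguments gC {n}.
Arguments gD {n}.
Arguments gH {n}.
Arguments gM {n}.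
Arguments gP {n} _.

Definition gen_code n (a : gen n) : 'I_4 + 'I_n.*2.+2 :=
  match a with
  | gC => inl (inord 0) | gD => inl (inord 1)
  | gH => inl (inord 2) | gM => inl (inord 3)
  | gP i => inr i
  end.

Definition gen_decode n (c : 'I_4 + 'I_n.*2.+2) : gen n :=
  match c with
  | inl i => nth gM [:: gC; gD; gH; gM] i
  | inr i => gP i
  end.

Lemma gen_codeK n : cancel (@gen_code n) (@gen_decode n).
Proof. by case=> //=; rewrite inordK. Qed.

HB.instance Definition _ n := Finite.copy (gen n) (can_type (@gen_codeK n)).

(* The underlying complex vector space of g_ell, with basis [gen n]. *)
Notation cga R n := {ffun gen n -> R[i]}.

Section LieAlgebra.
Variables (R : realType) (n : nat).
Local Notation g := (cga R n).

Definition egen (a : gen n) : g := [ffun b => (b == a)%:R].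

(* P_k, or 0 when k > 2 ell.  In [bracket_gen] the terms eP 0.-1 and
   eP (2 ell).+1 come with coefficient 0. *)
Definition eP (k : nat) : g := if insub k is Some i then egen (gP i) else 0.

(* I_k = (-1)^(k + ell + 1/2) k! (2 ell - k)!. *)
Definition Icoef (k : nat) : R :=
  (-1) ^+ (k + n.+1) * (k`! * (n.*2.+1 - k)`!)%:R.

Definition bracket_gen (a b : gen n) : g :=
  match a, b with
  | gD, gH => 2%:C *: egen gH
  | gH, gD => (- 2)%:C *: egen gH
  | gD, gC => (- 2)%:C *: egen gC
  | gC, gD => 2%:C *: egen gC
  | gC, gH => egen gD
  | gH, gC => - egen gD
  | gH, gP k => (- k%:R)%:C *: eP k.-1
  | gP k, gH => k%:R%:C *: eP k.-1
  | gD, gP k => (2 * (ell R n - k%:R))%:C *: eP k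
  | gP k, gD => (- (2 * (ell R n - k%:R)))%:C *: eP k
  | gC, gP k => (2 * ell R n - k%:R)%:C *: eP k.+1
  | gP k, gC => (- (2 * ell R n - k%:R))%:C *: eP k.+1
  | gP k, gP l => if (k + l == n.*2.+1)%N then (Icoef k)%:C *: egen gM else 0
  | _, _ => 0
  end.

Definition bracket (x y : g) : g :=
  \sum_(a : gen n) \sum_(b : gen n) (x a * y b) *: bracket_gen a b.

(* The action of the anti-involution omega on the basis;
   [rev_ord] sends k to 2 ell - k. *)
Definition omega (a : gen n) : gen n :=
  match a with
  | gC => gH | gD => gD | gH => gC | gM => gM | gP k => gP (rev_ord k)
  end.

(* (h, k) indexes C^h P_(ell+1/2)^(k_0) ... P_(2 ell)^(k_n). *)
Definition pbw : Type := (nat * {ffun 'I_n.+1 -> nat})%type.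

Definition level (x : pbw) : nat :=
  (2 * x.1 + \sum_(j < n.+1) (2 * j + 1) * x.2 j)%N.

Section Verma.
Variables (V : lmodType R[i]) (act : {bilinear g -> V -> V}) (v0 : V).

Definition pbw_vec (x : pbw) : V :=
  iter x.1 (act (egen gC))
    (foldr (fun (j : 'I_n.+1) w => iter (x.2 j) (act (eP (n.+1 + j))) w)
           v0 (enum 'I_n.+1)).

(* [act] makes V a g_ell-module, v0 is a highest weight vector of weight
   (delta, mu), and V = U(g^-) v0 freely: the PBW basis of U(g^-) applied to
   v0 is a basis of V. *)
Record is_verma (delta mu : R) : Prop := IsVerma {
  verma_bracket : forall (x y : g) (v : V),
    act (bracket x y) v = act x (act y v) - act y (act x v);
  verma_D : act (egen gD) v0 = delta%:C *: v0;
  verma_M : act (egen gM) v0 = mu%:C *: v0;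
  verma_H : act (egen gH) v0 = 0;
  verma_P : forall k : nat, (k <= n)%N -> act (eP k) v0 = 0;
  verma_span : forall v : V, exists (s : seq pbw) (c : pbw -> R[i]),
    v = \sum_(x <- s) c x *: pbw_vec x;
  verma_free : forall (s : seq pbw) (c : pbw -> R[i]), uniq s ->
    \sum_(x <- s) c x *: pbw_vec x = 0 -> forall x, x \in s -> c x = 0 }.

(* Linear in the first argument, conjugate-linear in the second. *)
Definition sesqform : Type :=
  {bilinear V -> V -> R[i] | *%R & Num.conj \; *%R}.

Record is_shapovalov (f : sesqform) : Prop := IsShapovalov {
  shapovalov_norm : f v0 v0 = 1;
  shapovalov_contra : forall (a : gen n) (x y : V),
    f (act (egen a) x) y = f x (act (egen (omega a)) y) }.

(* [s] lists the indices of the basis of the level-m subspace, in some order. *)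
Definition level_enum (m : nat) (s : seq pbw) : Prop :=
  uniq s /\ forall x : pbw, (x \in s) = (level x == m).

Definition kac_det (f : sesqform) (s : seq pbw) : R[i] :=
  \det (\matrix_(i < size s, j < size s)
          f (pbw_vec (tnth (in_tuple s) i)) (pbw_vec (tnth (in_tuple s) j))).

End Verma.

Lemma level_enum_ex (m : nat) : exists s : seq pbw, level_enum m s.
Proof.
pose F (z : 'I_m.+1 * {ffun 'I_n.+1 -> 'I_m.+1}) : pbw :=
  (z.1 : nat, [ffun j => z.2 j : nat]).
exists [seq x <- [seq F z | z <- enum {: 'I_m.+1 * {ffun 'I_n.+1 -> 'I_m.+1}}]
       | level x == m]; split.
  rewrite filter_uniq // map_inj_uniq ?enum_uniq // => -[a p] [b q] /= [ab pq].
  congr pair; first exact: val_inj.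
  by apply/ffunP => j; apply: val_inj; move/ffunP/(_ j): pq; rewrite !ffunE.
move=> x; rewrite mem_filter; case: eqP => //= lx.
have h1 : (x.1 < m.+1)%N.
  by rewrite ltnS -lx (leq_trans _ (leq_addr _ _)) // leq_pmull.
have h2 j : (x.2 j < m.+1)%N.
  rewrite ltnS -lx (leq_trans _ (leq_addl _ _)) // (bigD1 j) //=.
  by rewrite (leq_trans _ (leq_addr _ _)) // leq_pmull // addn1.
apply/mapP; exists (Ordinal h1, [ffun j => Ordinal (h2 j)]); first exact: mem_enum.
by rewrite /F /=; case: x {lx h1} h2 => h k h2; congr pair; apply/ffunP => j;
  rewrite !ffunE.
Qed.

End LieAlgebra.

(* Formal power series with coefficients in nat, as coefficient sequences. *)
Section PowerSeries.
Local Open Scope nat_scope.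

Definition fps := nat -> nat.

Definition fps_one : fps := fun k => (k == 0).
Definition fps_Xn (p : nat) : fps := fun k => (k == p).
Definition fps_add (a b : fps) : fps := fun k => a k + b k.
Definition fps_mul (a b : fps) : fps :=
  fun k => \sum_(i < k.+1) a i * b (k - i).

(* 1 / (1 - x^p) for p > 0; see [fps_geomE]. *)
Definition fps_geom (p : nat) : fps := fun k => (p %| k).

Lemma fps_geomE p : 0 < p -> fps_geom p =1
  fps_add fps_one (fps_mul (fps_Xn p) (fps_geom p)).
Proof.
move=> p0 k; rewrite /fps_geom /fps_add /fps_one /fps_mul /fps_Xn.
have [kp|pk] := ltnP k p.
  rewrite big1 ?addn0 => [|i _]; last first.
    have /negPf -> : (i : nat) != p by rewrite neq_ltn (leq_ltn_trans _ kp) // -ltnS.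
    by rewrite mul0n.
  by case: k kp => [|k] kp; rewrite ?dvdn0 ?gtnNdvd.
have k0 : k == 0 = false by apply/negbTE; rewrite -lt0n (leq_trans p0).
rewrite k0 add0n (bigD1 (Ordinal (pk : p < k.+1))) //= eqxx mul1n big1 ?addn0.
  by rewrite dvdn_subl.
by move=> i; rewrite -val_eqE /= => /negPf ->; rewrite mul0n.
Qed.

(* 1/(1-x^2) prod_(j <= ell-1/2) 1/(1-x^(2j+1)) *)
Definition kac_d (n : nat) : fps :=
  fps_mul (fps_geom 2)
    (\big[fps_mul/fps_one]_(j < n.+1) fps_geom (2 * j + 1)).

(* (sum_(i <= ell-1/2) x^(2i+1)/(1-x^(2i+1))) times the series [kac_d] *)
Definition kac_e (n : nat) : fps :=
  fps_mul
    (\big[fps_add/fun=> 0]_(i < n.+1)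
       fps_mul (fps_Xn (2 * i + 1)) (fps_geom (2 * i + 1)))
    (kac_d n).

End PowerSeries.

(* Main.v *)
From HB Require Import structures.
Require Import Defs.
From mathcomp Require Import all_boot all_order all_algebra all_fingroup.
From mathcomp Require Import sesquilinear reals complex ring zify.
Import GRing.Theory Num.Theory.
Local Open Scope ring_scope.
Set Implicit Arguments.
Unset Strict Implicit.
Unset Printing Implicit Defensive.

(* For mu <> 0, adding to C and H suitable quadratic expressions in the P's
   divided by mu gives Ct and Ht commuting with every P_k; they generate an
   sl_2-triple whose Cartan element Dt = [Ct, Ht] has eigenvalue
   delta + (ell + 1/2)^2 / 2 on v0.  The vectors Ct^h P^k v0 are pairwise
   orthogonal, being products of ladder states of commuting oscillators, and
   they differ from C^h P^k v0 by vectors of the same level with fewer factors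
   C.  So the base change is unitriangular and the Kac determinant is the
   product of the squared norms; the exponents count pairs (x, i) with i below
   the exponent of C, resp. of the P's, in the basis vector x.
   For mu = 0 and m > 0, P_(ell+1/2)^m v0 is orthogonal to its whole level, so
   both sides vanish. *)

(** * Counting the indices of a level *)

Section Truncation.
Variable B : nat.
Implicit Types (a b : fps) (p q : {poly nat}).

(** Passing to [{poly nat}] makes the expansion of a product of sums available for series. *)
Definition coef_agree a p := forall k, (k < B)%N -> a k = p`_k.

Lemma coef_agreeM a b p q :
  coef_agree a p -> coef_agree b q -> coef_agree (fps_mul a b) (p * q).
Proof.
move=> ap bq k kB; rewrite /fps_mul coefM; apply: eq_bigr => i _.
rewrite ap; last exact: leq_trans (ltn_ord i) kB.
by rewrite bq // (leq_ltn_trans (leq_subr _ _) kB).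
Qed.

Lemma coef_agree1 : coef_agree fps_one 1.
Proof. by move=> k _; rewrite coef1 natn. Qed.

Lemma coef_agree_prod (I : Type) (r : seq I) (a : I -> fps) (p : I -> {poly
  nat}) :
  (forall i, coef_agree (a i) (p i)) ->
  coef_agree (\big[fps_mul/fps_one]_(i <- r) a i) (\prod_(i <- r) p i).
Proof.
move=> ap; elim: r => [|i r IH]; first by rewrite !big_nil; exact: coef_agree1.
by rewrite !big_cons; apply: coef_agreeM.
Qed.

Lemma coef_agree_geom w : (0 < w)%N ->
  coef_agree (fps_geom w) (\sum_(i < B) 'X^(w * i)).
Proof.
move=> w0 k kB; rewrite coef_sum /fps_geom.
under eq_bigr do rewrite coefXn.
have [/dvdnP[c kE]|ndv] := boolP (w %| k)%N; last first.
  by rewrite big1 // => i _; case: eqP ndv => // ->; rewrite dvdn_mulr.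
have cB : (c < B)%N by apply: leq_ltn_trans kB; rewrite kE leq_pmulr.
rewrite (bigD1 (Ordinal cB)) //= kE mulnC eqxx big1 // => i.
by rewrite -val_eqE /= eqn_pmul2l // eq_sym => /negPf ->.
Qed.

End Truncation.

Lemma fps_mul_suml (I : Type) (r : seq I) (a : I -> fps) b k :
  fps_mul (\big[fps_add/fun=> 0%N]_(i <- r) a i) b k =
  (\sum_(i <- r) fps_mul (a i) b k)%N.
Proof.
rewrite [RHS]exchange_big; apply: eq_bigr => j _ /=.
rewrite -big_distrl /=; congr (_ * _)%N.
by elim: r => [|i r IH]; rewrite ?big_nil // !big_cons /fps_add IH.
Qed.

(** The series x^w / (1 - x^w) has coefficient 1 exactly at the positive multiples of w. The range c
    < m loses none of them, since w (c + 1) <= m forces c < m. *)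
Lemma fps_mul_shift_geom w (b : fps) m : (0 < w)%N ->
  fps_mul (fps_mul (fps_Xn w) (fps_geom w)) b m =
  (\sum_(0 <= c < m | (w * c.+1 <= m)%N) b (m - w * c.+1))%N.
Proof.
move=> w0.
have shiftE i : fps_mul (fps_Xn w) (fps_geom w) i =
    ((0 < i) && (w %| i))%N :> nat.
  rewrite /fps_mul /fps_Xn /fps_geom; have [iw|wi] := ltnP i w.
    rewrite big1 => [|j _]; last first.
      by rewrite ltn_eqF ?mul0n // (leq_ltn_trans _ iw) // -ltnS.
    by case: i iw => // i iw; rewrite gtnNdvd.
  rewrite (bigD1 (Ordinal (wi : w < i.+1)%N)) //= eqxx mul1n big1 ?addn0.
    by rewrite dvdn_subl // (leq_trans w0 wi).
  by move=> j; rewrite -val_eqE /= => /negPf ->.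
rewrite [LHS](eq_bigr (fun i : 'I_m.+1 => ((0 < i) && (w %| i)) * b (m -
  i))%N); last first.
  by move=> i _; rewrite shiftE.
rewrite -(big_mkord xpredT (fun i => ((0 < i) && (w %| i)) * b (m - i))%N).
rewrite big_nat_recl //= mul0n add0n.
under eq_bigr do rewrite mulnbl.
rewrite -big_mkcond /=.
rewrite -[LHS]big_filter -[RHS]big_filter.
rewrite -(big_map (fun c => w * c.+1)%N xpredT (fun i => b (m - i)%N)).
rewrite -(big_map succn xpredT (fun i => b (m - i)%N)).
(* Both lists enumerate the positive multiples of [w] up to [m], one as successors i + 1, the other
   as w (c + 1). *)
apply: perm_big; apply: uniq_perm.
- by rewrite map_inj_uniq ?filter_uniq ?iota_uniq //; exact: succn_inj.
- rewrite map_inj_uniq ?filter_uniq ?iota_uniq // => x y /eqP.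
  by rewrite eqn_pmul2l // eqSS => /eqP.
move=> i; apply/mapP/mapP => -[c]; rewrite mem_filter mem_index_iota /=.
  move=> /andP[/dvdnP[[|q] cE] cm] ->; rewrite ?mul0n // in cE *.
  exists q; last by rewrite cE mulnC.
  by rewrite mem_filter mem_index_iota mulnC -cE cm (leq_trans _ cm) // cE
    leq_pmulr.
have pE : ((w * c.+1).-1.+1 = w * c.+1)%N by rewrite prednK // muln_gt0 w0.
move=> /andP[wc cm] ->; exists (w * c.+1).-1; rewrite ?pE //.
by rewrite mem_filter mem_index_iota pE dvdn_mulr.
Qed.

(** * Number of indices in a level, and total exponents *)

Section LevelCount.
Variable n : nat.
Implicit Types (m : nat) (s : seq (pbw n)) (x : pbw n).

Lemma level_enum_perm m s t : level_enum m s -> level_enum m t -> perm_eq s t.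
Proof.
by move=> [us sE] [ut tE]; apply: uniq_perm => // x; rewrite sE tE.
Qed.

(** When the product of geometric sums is expanded, each choice of exponents contributes X to the
    power of its level. Exponents in level m are at most m, so neither the truncation nor the finite
    type [T] loses an index. *)
Lemma level_enum_size m s : level_enum m s -> size s = kac_d n m.
Proof.
move=> es; pose T := ('I_m.+1 * {ffun 'I_n.+1 -> 'I_m.+1})%type.
pose F (z : T) : pbw n := (z.1 : nat, [ffun j => z.2 j : nat]).
have Finj : injective F.
  move=> -[a p] [b q] [ab pq]; congr pair; first exact: val_inj.
  by apply/ffunP => j; apply: val_inj; move/ffunP/(_ j): pq; rewrite !ffunE.
pose t := [seq F z | z <- enum [pred z | level (F z) == m]].
have et : level_enum m t.
  split; first by rewrite map_inj_uniq ?enum_uniq.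
  move=> x; apply/mapP/idP => [[z]|/eqP lx].
    by rewrite mem_enum => zm ->.
  have h1 : (x.1 < m.+1)%N.
    by rewrite ltnS -lx (leq_trans _ (leq_addr _ _)) // leq_pmull.
  have h2 j : (x.2 j < m.+1)%N.
    rewrite ltnS -lx (leq_trans _ (leq_addl _ _)) // (bigD1 j) //=.
    by rewrite (leq_trans _ (leq_addr _ _)) // leq_pmull // addn1.
  have xE : x = F (Ordinal h1, [ffun j => Ordinal (h2 j)]).
    rewrite /F /=; case: x {lx h1} h2 => h k h2; congr pair; apply/ffunP => j.
    by rewrite !ffunE.
  by exists (Ordinal h1, [ffun j => Ordinal (h2 j)]);
    rewrite // mem_enum inE -xE lx.
rewrite (perm_size (level_enum_perm es et)) size_map -cardE.
have -> : kac_d n m =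
    ((\sum_(i < m.+1) 'X^(2 * i)) *
     \prod_(j < n.+1) \sum_(i < m.+1) 'X^((2 * j + 1) * i) : {poly nat})`_m.
  apply: (@coef_agreeM m.+1) => //; first exact: coef_agree_geom.
  apply: coef_agree_prod => j; apply: coef_agree_geom; by rewrite addn1.
rewrite bigA_distr_bigA /= big_distrlr /= pair_big /= coef_sum -sum1_card
  big_mkcond.
apply: eq_bigr => -[h k] _ /=.
have -> : \prod_(i < n.+1) 'X^((2 * i + 1) * k i) =
    'X^(\sum_(i < n.+1) (2 * i + 1) * k i) :> {poly nat}.
  by elim/big_rec2: _ => [|i a b _ ->]; rewrite ?expr0 // -exprD.
rewrite -exprD coefXn inE eq_sym /level /=.
by under [X in (_ + X)%N]eq_bigr do rewrite ffunE; case: eqP.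
Qed.

(* Deleting a common part of all indices satisfying [Q] is a bijection onto
   the indices of a lower level. *)
Lemma level_enum_count m p s (Q : pred (pbw n)) (up dn : pbw n -> pbw n) :
  level_enum (m + p)%N s ->
  cancel up dn -> (forall x, Q x -> up (dn x) = x) -> (forall x, Q (up x)) ->
  (forall x, level (up x) = (level x + p)%N) -> count Q s = kac_d n m.
Proof.
move=> [us sE] upK dnK Qup lup; rewrite -size_filter.
rewrite -(size_map dn) (@level_enum_size m) //; split.
  rewrite map_inj_in_uniq ?filter_uniq // => x y.
  by rewrite !mem_filter => /andP[Qx _] /andP[Qy _] /(congr1 up); rewrite !dnK.
move=> x; apply/mapP/idP => [[y]|lx].
  rewrite mem_filter sE => /andP[Qy ly] ->.
  by rewrite -(eqn_add2r p) -lup dnK.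
by exists (up x); rewrite ?upK // mem_filter Qup sE lup eqn_add2r.
Qed.

(** The common part is C^(i + 1), of level 2 (i + 1). *)
Lemma count_pbw1_gt m s i : level_enum m s -> (i < m./2)%N ->
  count (fun x => (i < x.1)%N) s = kac_d n (m - 2 * (i + 1))%N.
Proof.
move=> es im.
have le : (2 * (i + 1) <= m)%N.
  rewrite mul2n addn1 -(odd_double_half m); apply: leq_trans (leq_addl _ _).
  by rewrite leq_double.
apply: (@level_enum_count _ (2 * (i + 1))%N _ _
  (fun x => (x.1 + i.+1, x.2)%N) (fun x => (x.1 - i.+1, x.2)%N)).
- by rewrite subnK.
- by move=> [h k]; rewrite /= addnK.
- by move=> [h k] /= hi; rewrite subnK.
- by move=> [h k] /=; rewrite leq_addl.
- by move=> [h k]; rewrite /level /= mulnDr addn1 addnAC.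
Qed.

Definition ffun_upd (k : {ffun 'I_n.+1 -> nat}) j c : {ffun 'I_n.+1 -> nat} :=
  [ffun i => if i == j then c else k i].

(** Written additively because [c] may lie on either side of [k j]. *)
Lemma level_upd h k j c :
  (level (h, ffun_upd k j c) + (2 * j + 1) * k j =
   level (h, k) + (2 * j + 1) * c)%N.
Proof.
rewrite /level /= !(bigD1 (P := xpredT) j) //= ffunE eqxx.
under eq_bigr => i /negPf ij do rewrite ffunE ij.
rewrite !addnA addnAC [RHS]addnAC; congr addn; exact: addnAC.
Qed.

(** The common part consists of c + 1 factors P_(ell+1/2+j), each of level 2 j + 1. *)
Lemma count_pbw2_gt m s (j : 'I_n.+1) c : level_enum m s ->
  ((2 * j + 1) * c.+1 <= m)%N ->
  count (fun x => (c < x.2 j)%N) s = kac_d n (m - (2 * j + 1) * c.+1)%N.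
Proof.
move=> es le.
have updK k a b : ffun_upd (ffun_upd k j a) j b = ffun_upd k j b.
  by apply/ffunP => i; rewrite !ffunE; case: eqP.
have upd_id k : ffun_upd k j (k j) = k.
  by apply/ffunP => i; rewrite !ffunE; case: eqP => // ->.
apply: (@level_enum_count _ ((2 * j + 1) * c.+1)%N _ _
  (fun x => (x.1, ffun_upd x.2 j (x.2 j + c.+1)%N))
  (fun x => (x.1, ffun_upd x.2 j (x.2 j - c.+1)%N))).
- by rewrite subnK.
- by move=> [h k]; rewrite /= updK ffunE eqxx addnK upd_id.
- by move=> [h k] /= hi; rewrite updK ffunE eqxx subnK // upd_id.
- by move=> [h k] /=; rewrite ffunE eqxx leq_addl.
move=> [h k] /=; apply/eqP; rewrite -(eqn_add2r ((2 * j + 1) * k j)%N).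
by rewrite level_upd mulnDr addnA addnAC.
Qed.

Lemma pbw1_le_half m s x : level_enum m s -> x \in s -> (x.1 <= m./2)%N.
Proof.
move=> [_ sE]; rewrite sE => /eqP <-; rewrite -[x.1]doubleK half_leq //.
by rewrite -mul2n leq_addr.
Qed.

Lemma pbw2_le_level x (j : 'I_n.+1) : ((2 * j + 1) * x.2 j <= level x)%N.
Proof.
rewrite /level (bigD1 j) //= addnCA; exact: leq_addr.
Qed.

(** An exponent k is the number of c < k. After exchanging the sums, [count_pbw2_gt] counts the x
    with c < x.2 j, and summing over c gives the coefficient of x^w / (1 - x^w) times [kac_d], where
    w = 2 j + 1. *)
Lemma level_enum_e m s : level_enum m s ->
  (\sum_(x <- s) \sum_(j < n.+1) x.2 j)%N = kac_e n m.
Proof.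
(* The condition w (c + 1) <= m is automatic for c < k; it is inserted to match
   [fps_mul_shift_geom]. *)
move=> es; have dropE w (k : nat) : (0 < w)%N -> (w * k <= m)%N ->
    k = (\sum_(0 <= c < m | (w * c.+1 <= m)) (c < k))%N :> nat.
  move=> w0 wk; rewrite big_mkcond /=.
  have km : (k <= m)%N by apply: leq_trans wk; rewrite leq_pmull.
  rewrite (big_cat_nat (n := k)) //= [X in (_ + X)%N]big_nat_cond.
  rewrite [X in (_ + X)%N]big1 ?addn0 => [|c /andP[/andP[kc _] _]]; last first.
    by rewrite ltnNge kc; case: ifP.
  rewrite -[LHS]muln1 -[X in (X * _)%N]subn0 -sum_nat_const_nat.
  rewrite big_nat_cond [RHS]big_nat_cond;
    apply: eq_bigr => c /andP[/andP[_ ck] _].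
  by rewrite ck (leq_trans _ wk) // leq_mul2l ck orbT.
rewrite exchange_big /= /kac_e.
rewrite fps_mul_suml; apply: eq_bigr => j _.
have w0 : (0 < 2 * j + 1)%N by rewrite addn1.
rewrite fps_mul_shift_geom //.
transitivity (\sum_(x <- s) \sum_(0 <= c < m | ((2 * j + 1) * c.+1 <= m)%N)
    (c < x.2 j))%N.
  apply: eq_big_seq => x; case: es => _ -> /eqP lx; apply: dropE => //.
  by rewrite -lx pbw2_le_level.
rewrite exchange_big /=; apply: eq_bigr => c le.
rewrite -(count_pbw2_gt es le) -sum1_count [RHS]big_mkcond /=.
by apply: eq_bigr => x _; case: ifP.
Qed.


End LevelCount.

(** * Gram determinants *)

(* In the Leibniz expansion a permutation that never increases the rank [r]
   preserves it, because the ranks have the same sum before and after. *)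
Lemma det_unitriangular (F : comNzRingType) N (A : 'M[F]_N) (r : 'I_N -> nat) :
  (forall i, A i i = 1) -> (forall i j, i != j -> (r i <= r j)%N -> A i j = 0) ->
  \det A = 1.
Proof.
move=> A1 A0; rewrite /determinant (bigD1 (1%g : {perm 'I_N})) //= [X in _ +
  X]big1 => [|p p1].
  by rewrite odd_perm1 expr0 mul1r addr0 big1 // => i _; rewrite perm1.
have [/existsP[i /andP[pi rpi]]|] :=
    boolP [exists i, (p i != i) && (r i <= r (p i))%N].
  by rewrite (bigD1 i) //= (A0 i (p i)) ?mul0r ?mulr0 // eq_sym.
rewrite negb_exists => /forallP rp.
have rle i : (r (p i) <= r i)%N.
  by have := rp i; rewrite negb_and negbK -ltnNge => /orP[/eqP->|/ltnW].
have : (\sum_i r (p i) == \sum_i r i)%N.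
  by apply/eqP; symmetry; apply: (reindex_inj (@perm_inj _ p)).
rewrite (leqif_sum (fun i _ => leqif_eq (rle i))) => /forallP req.
case/eqP: p1; apply/permP => i; rewrite perm1; apply/eqP.
by have := rp i; rewrite negb_and negbK (eqP (req i)) leqnn orbF.
Qed.

(** If A expresses v in terms of w, the Gram matrix of v is A times a diagonal matrix times the
    conjugate transpose of A, and A has determinant 1. *)
Lemma det_gram_unitriangular (F : numClosedFieldType) (V : lmodType F)
    (f : {bilinear V -> V -> F | *%R & Num.conj \; *%R})
    (T : choiceType) (s : seq T) (r : T -> nat) (v w : T -> V) :
  uniq s ->
  (forall x, x \in s -> exists2 c : T -> F,
     v x = w x + \sum_(y <- s) c y *: w y &
     forall y, (r x <= r y)%N -> c y = 0) ->
  (forall x y, x != y -> f (w x) (w y) = 0) ->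
  \det (\matrix_(i < size s, j < size s)
          f (v (tnth (in_tuple s) i)) (v (tnth (in_tuple s) j))) =
  \prod_(x <- s) f (w x) (w x).
Proof.
move=> us vw orth; pose t i := tnth (in_tuple s) i.
have tinj : injective t.
  move=> i j; rewrite /t !(tnth_nth (t i)) /= => /eqP.
  by rewrite nth_uniq // => /eqP; exact: val_inj.
have /fin_all_exists2[c vE c0] : forall i : 'I_(size s), exists2 c : T -> F,
     v (t i) = w (t i) + \sum_(y <- s) c y *: w y &
     forall y, (r (t i) <= r y)%N -> c y = 0.
  by move=> i; apply: vw; exact: mem_tnth.
pose A := \matrix_(i, j) ((i == j)%:R + c i (t j)).
have AE i j : A i j = (i == j)%:R + c i (t j) by rewrite mxE.
clearbody A; pose Gw := diag_mx (\row_i f (w (t i)) (w (t i))).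
have vA i : v (t i) = \sum_j A i j *: w (t j).
  under eq_bigr do rewrite AE scalerDl.
  rewrite big_split /= vE [X in _ + X = _]big_tnth; congr (_ + _).
  rewrite (bigD1 i) //= eqxx scale1r big1 ?addr0 // => j.
  by rewrite eq_sym => /negPf ->; rewrite scale0r.
have detA : \det A = 1.
  apply: (det_unitriangular (r := r \o t)) => [i|i j ij rij].
    by rewrite AE eqxx c0 ?addr0.
  by rewrite AE (negPf ij) c0 ?addr0.
have -> : \matrix_(i < size s, j < size s) f (v (t i)) (v (t j)) =
    A *m Gw *m (map_mx Num.conj A)^T.
  apply/matrixP => i j; rewrite !mxE vA linear_sumlz.
  apply: eq_bigr => k _; rewrite linearZl_LR /= mul_mx_diag !mxE -mulrA.
  congr (_ * _); rewrite vA linear_sum (bigD1 k) //= linearZr_LR /= big1 ?addr0.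
    exact: mulrC.
  by move=> l lk; rewrite linearZr_LR /= orth ?mulr0 // (inj_eq tinj) eq_sym.
rewrite !det_mulmx det_tr det_map_mx detA rmorph1 mul1r mulr1 det_diag.
by rewrite [RHS]big_tnth; apply: eq_bigr => i _; rewrite mxE.
Qed.

(** * Decoupling of the oscillators *)

(** Collapses the sums in which a commutator [P_a, P_b] leaves a single index. *)
Lemma sum_ord_delta (V : nmodType) N j (E : nat -> V) :
  \sum_(k < N) (if k == j :> nat then E k else 0) = if (j < N)%N then E j else 0.
Proof.
rewrite -big_mkcond /=; case: ltnP => jN.
  by rewrite (big_pred1 (Ordinal jN)).
by rewrite big1 // => k /eqP kj; move: (ltn_ord k); rewrite kj ltnNge jN.
Qed.

Lemma sum_ord_delta_rev (V : nmodType) N j (E : nat -> V) :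
  \sum_(k < N) (if (k + j == N)%N then E k else 0) =
  if (0 < j <= N)%N then E (N - j)%N else 0.
Proof.
have [jN|jN] := boolP (0 < j <= N)%N; last first.
  by rewrite big1 // => k _; case: eqP => // e; have := ltn_ord k; lia.
rewrite -[RHS](_ : (if (N - j < N)%N then E (N - j)%N else 0) = _);
  last by case: ltnP => //; lia.
rewrite -sum_ord_delta; apply: eq_bigr => k _.
by have -> : (k + j == N)%N = (k == N - j :> nat)%N by apply/eqP/eqP; lia.
Qed.

(** Each A on the left moves to the right as B and removes one A there, at the cost of a real
    factor. If a and b differ, one side runs out first and B then meets a vector that it kills. *)
Lemma ladder_orthogonal (F : numClosedFieldType) (V : lmodType F)
    (f : {bilinear V -> V -> F | *%R & Num.conj \; *%R})
    (A B : V -> V) (r : nat -> F) (X Y : V) :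
  (forall x y, f (A x) y = f x (B y)) -> (forall x y, f (B x) y = f x (A y)) ->
  (forall c, r c \is Num.real) -> B X = 0 -> B Y = 0 ->
  (forall c, B (iter c.+1 A Y) = r c *: iter c A Y) ->
  forall a b, f (iter a A X) (iter b A Y) =
    if a == b then (\prod_(i < a) r i) * f X Y else 0.
Proof.
move=> fAB fBA rR BX BY BA; elim=> [|a IH] [|b].
- by rewrite big_ord0 mul1r.
- by rewrite /= -fBA BX linear0l.
- by rewrite /= fAB BY linear0r.
rewrite iterS fAB BA linearZr_LR /= IH eqSS conj_Creal //.
by case: eqP => [->|]; rewrite ?mulr0 // big_ord_recr /= mulrA [r b * _]mulrC.
Qed.

(** * Operators satisfying the relations of the algebra, and their Fock states *)

Section OscillatorModule.
Variables (F : numClosedFieldType) (n : nat).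
Local Notation N := n.*2.+1.
Variables (V : lmodType F) (C H D : {linear V -> V}) (P : nat -> {linear V -> V}).
Variables (I : nat -> F) (delta mu : F) (v0 : V).

Hypothesis I_neq0 : forall k, I k != 0.
Hypothesis I_rec : forall k, (k < N)%N -> I k.+1 * (N - k)%:R = - (k.+1%:R * I k).
Hypothesis I_sym : forall k, (k <= N)%N -> I (N - k) = - I k.
Hypothesis CP : forall k v, (k <= N)%N ->
  C (P k v) = P k (C v) + (N - k)%:R *: P k.+1 v.
Hypothesis HP : forall k v, (k <= N)%N ->
  H (P k v) = P k (H v) - k%:R *: P k.-1 v.
Hypothesis DP : forall k v, (k <= N)%N ->
  D (P k v) = P k (D v) + (N%:R - 2 * k%:R) *: P k v.
Hypothesis PP : forall a b v,
  P a (P b v) = P b (P a v) + (if (a + b == N)%N then I a * mu else 0) *: v.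
Hypothesis CH : forall v, C (H v) = H (C v) + D v.
Hypothesis DC : forall v, D (C v) = C (D v) - 2 *: C v.
Hypothesis Hv0 : H v0 = 0.
Hypothesis Dv0 : D v0 = delta *: v0.
Hypothesis Pv0 : forall k, (k <= n)%N -> P k v0 = 0.

(** The list [L] stays general to allow induction on it; the basis uses [enum 'I_n.+1]. *)
Definition fock (L : seq 'I_n.+1) (k : {ffun 'I_n.+1 -> nat}) : V :=
  foldr (fun (j : 'I_n.+1) w => iter (k j) (P (n.+1 + j)) w) v0 L.

Lemma iter_P_comm a b c v : (a + b != N)%N ->
  P a (iter c (P b) v) = iter c (P b) (P a v).
Proof.
move=> /negPf ab; elim: c => //= c IH.
by rewrite PP ab scale0r addr0 IH.
Qed.

(** P (n - j) and P (n.+1 + j) annihilate and create in the j-th oscillator: their indices add up to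
    N, so their commutator is the scalar I (n - j) mu. For c = 0 the default [c.-1] has coefficient
    0. *)
Lemma iter_P_lower (j : 'I_n.+1) c v : P (n - j) v = 0 ->
  P (n - j) (iter c (P (n.+1 + j)) v) =
  (c%:R * (I (n - j) * mu)) *: iter c.-1 (P (n.+1 + j)) v.
Proof.
move=> Pv; have jn := ltn_ord j; have e : (n - j + (n.+1 + j) == N)%N by lia.
elim: c => [|c IH]; first by rewrite mul0r scale0r /= Pv.
rewrite [iter c.+1 _ _]/= PP e IH linearZ /=; case: c IH => [|c] IH.
  by rewrite !mul0r scale0r add0r mul1r.
by rewrite /= -scalerDl; congr (_ *: _); rewrite -[c.+2]addn1 natrD mulrDl mul1r.
Qed.

Lemma fock_notin L k j c : j \notin L -> fock L (ffun_upd k j c) = fock L k.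
Proof.
elim: L => //= i L IH; rewrite inE negb_or => /andP[ji jL].
by rewrite IH // ffunE eq_sym (negPf ji).
Qed.

(** P (n - j) commutes with every creation operator except the j-th, and it kills v0. *)
Lemma fock_annihilated L k (j : 'I_n.+1) : j \notin L -> P (n - j) (fock L k) = 0.
Proof.
elim: L => [_|i L IH] /=; first by rewrite Pv0 // leq_subr.
rewrite inE negb_or => /andP[ji jL]; rewrite iter_P_comm ?IH //.
  by elim: (k i) => //= c ->; rewrite linear0.
by move: ji; rewrite -val_eqE /=; have := ltn_ord j; lia.
Qed.

Lemma fock_raise L k (j : 'I_n.+1) : uniq L -> j \in L ->
  P (n.+1 + j) (fock L k) = fock L (ffun_upd k j (k j).+1).
Proof.
elim: L => //= i L IH /andP[iL uL]; rewrite inE ffunE.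
case: (eqVneq j i) => [-> _|ji /= jL]; first by rewrite /= fock_notin.
rewrite iter_P_comm ?IH //; lia.
Qed.

Lemma fock_lower L k (j : 'I_n.+1) : uniq L -> j \in L ->
  P (n - j) (fock L k) =
  ((k j)%:R * (I (n - j) * mu)) *: fock L (ffun_upd k j (k j).-1).
Proof.
elim: L => //= i L IH /andP[iL uL]; rewrite inE ffunE.
case: (eqVneq j i) => [ji _|ji /= jL].
  by rewrite ji fock_notin // iter_P_lower // fock_annihilated.
rewrite iter_P_comm ?IH //.
  by elim: (k i) => //= c ->; rewrite linearZ.
by move: ji; rewrite -val_eqE /=; have := ltn_ord j; lia.
Qed.

(** * The contravariant form on Fock states *)

Section Form.
Variable f : {bilinear V -> V -> F | *%R & Num.conj \; *%R}.
Hypothesis f_v0 : f v0 v0 = 1.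
Hypothesis f_C : forall x y, f (C x) y = f x (H y).
Hypothesis f_H : forall x y, f (H x) y = f x (C y).
Hypothesis f_P : forall k x y, (k <= N)%N -> f (P k x) y = f x (P (N - k) y).
Hypothesis mu_real : mu \is Num.real.
Hypothesis I_real : forall k, I k \is Num.real.

(** The contribution of the j-th oscillator, equal to (k j)! (I (n - j) mu)^(k j); it can be
    negative. *)
Definition fock_norm (k : {ffun 'I_n.+1 -> nat}) (j : 'I_n.+1) : F :=
  \prod_(i < k j) (i.+1%:R * (I (n - j) * mu)).

(** One oscillator is peeled off at a time: the state of the remaining ones is killed by P (n - j),
    so the ladder argument applies. *)
Lemma fock_orthogonal L k l : uniq L ->
  f (fock L k) (fock L l) =
  if all (fun j => k j == l j) L then \prod_(j <- L) fock_norm k j else 0.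
Proof.
elim: L => [|j L IH] /=; first by rewrite big_nil.
move=> /andP[jL uL]; have jn := ltn_ord j.
rewrite (@ladder_orthogonal _ _ f _ (P (n - j)) (fun i => i.+1%:R * (I (n - j)
  * mu))).
- rewrite IH // big_cons; case: eqP => // _.
  by case: all; rewrite ?mulr0.
- by move=> x y; rewrite f_P; [congr (f _ (P _ _)) |]; lia.
- by move=> x y; rewrite f_P; [congr (f _ (P _ _)) |]; lia.
- by move=> c; rewrite !rpredM ?realn.
- by rewrite fock_annihilated.
- by rewrite fock_annihilated.
by move=> c; rewrite iter_P_lower // fock_annihilated.
Qed.

(** The second vector is P_(n+1)^c v0. Without factors C, the oscillator j = 0 contributes a factor
    mu. Otherwise one C moves across as H, which turns some P_(n+1) into a multiple of P_n; for mu =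
    0 this P_n commutes with P_(n+1) and kills v0. *)
Lemma fock_radical (x : pbw n) c : mu = 0 -> (0 < c)%N ->
  f (iter x.1 C (fock (enum 'I_n.+1) x.2))
    (fock (enum 'I_n.+1) [ffun j => if j == ord0 then c else 0%N]) = 0.
Proof.
move=> mu0 c0; case: x => [[|h] k] /=.
  rewrite fock_orthogonal ?enum_uniq //; case: ifP => // /allP /(_ ord0).
  rewrite mem_enum ffunE eqxx => /(_ isT) /eqP kc.
  rewrite (perm_big (index_enum _)) /=; last first.
    by apply: uniq_perm; rewrite ?enum_uniq ?index_enum_uniq // => j;
       rewrite mem_enum mem_index_enum.
  rewrite (bigD1 ord0) //= /fock_norm kc mu0.
  by case: c c0 kc => // c _ _; rewrite big_ord_recl !mulr0 !mul0r.
rewrite f_C; set y := fock _ [ffun _ => _]; suff -> : H y = 0 by rewrite linear0r.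
have -> : y = iter c (P n.+1) v0.
  rewrite /y enum_ordSl /= ffunE eqxx addn0; congr iter.
  elim: (enum 'I_n) => //= i L IH; rewrite ffunE -val_eqE /=.
  by move: IH; rewrite /fock => ->.
elim: {y c0} c => //= c IH.
rewrite HP; last by rewrite ltnS -addnn leq_addr.
rewrite IH linear0 /= add0r.
have -> : P n (iter c (P n.+1) v0) = 0; last by rewrite scaler0 oppr0.
by elim: c {IH} => [|c IH] /=;
  rewrite ?Pv0 // PP IH linear0 mu0 mulr0 if_same scale0r addr0.
Qed.

End Form.

(** * The operators Ct, Ht and Dt for nonzero mu *)

Section Decoupling.
Hypothesis mu_neq0 : mu != 0.

(* The coefficient is forced by [Ct, P_j] = 0: summands k = j and
   k = N - j - 1 of [sug_form] each cancel half of [C, P_j]. *)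
Definition sug k : F := (N - k)%:R / (2 * (I k * mu)).

Lemma sugI k : sug k * (I k * mu) = (N - k)%:R / 2.
Proof. rewrite /sug; field; by rewrite I_neq0 mu_neq0. Qed.

(** [I_rec] relates I (k + 1) to I k, so one coefficient serves both commutators arising from a
    summand. *)
Lemma sugIS k : (k < N)%N -> sug k * (I k.+1 * mu) = - (k.+1%:R / 2).
Proof.
move=> kN; have e : I k.+1 * (N - k)%:R * (2 * I k)^-1 = - (k.+1%:R / 2).
  rewrite I_rec //; field; exact: I_neq0.
rewrite -e /sug; field; by rewrite I_neq0 mu_neq0.
Qed.

(** A Sugawara-type construction. P_a P_b has D-weight 2 N - 2 (a + b), so the indices must add up
    to N + 1 in the correction of C and to N - 1 in that of H. [Dt] is the commutator [Ct, Ht]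
    written out. *)
Definition sug_form (v : V) : V := \sum_(k < N) sug k *: P k.+1 (P (N - k) v).
Definition Ct v := C v + sug_form v.
Definition Ht v := H v + \sum_(k < N) sug k *: P k (P (N - k.+1) v).
Definition Dt v := D v + \sum_(k < N) sug k *:
  (k.+1%:R *: P k (P (N - k) v) + (N - k)%:R *: P k.+1 (P (N - k.+1) v)).

Lemma Ct_linear : linear Ct.
Proof.
move=> a u v; rewrite /Ct /sug_form linearP scalerDr scaler_sumr.
rewrite addrACA -big_split; congr (_ + _); apply: eq_bigr => k _ /=.
by rewrite !linearP.
Qed.

HB.instance Definition _ := GRing.isLinear.Build F V V *:%R Ct Ct_linear.

Lemma CtP j v : (j <= N)%N -> Ct (P j v) = P j (Ct v).
Proof.
move=> jN; rewrite /Ct /sug_form CP // linearD linear_sum /= -addrA;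
  congr (_ + _).
have PPP (k : 'I_N) : sug k *: P k.+1 (P (N - k) (P j v)) =
    P j (sug k *: P k.+1 (P (N - k) v)) +
    ((if k == j :> nat then - ((N - k)%:R / 2) *: P k.+1 v else 0) +
     (if (k + j.+1 == N)%N then - (k.+1%:R / 2) *: P (N - k) v else 0)).
  have kN := ltn_ord k.
  rewrite [P _ (P j v)]PP linearD linearZ /= [P _ (P j _)]PP linearZ /=
    !scalerDr !scalerA -addrA.
  rewrite I_sym ?(ltnW kN) // -sugIS // -sugI addnS -addSn; congr (_ + _).
  have -> : (N - k + j == N)%N = (k == j :> nat)%N by apply/eqP/eqP; lia.
  rewrite addrC; congr (_ + _); case: eqP => _; rewrite ?mulr0 ?scale0r //.
  by rewrite mulNr mulrN.
rewrite (eq_bigr _ (fun k _ => PPP k)) !big_split /= [LHS]addrCA -[RHS]addr0;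
  congr (_ + _).
have /= -> := sum_ord_delta N j (fun k => - ((N - k)%:R / 2) *: P k.+1 v).
have /= -> := sum_ord_delta_rev N j.+1 (fun k => - (k.+1%:R / 2) *: P (N - k) v).
(* For j = N neither special summand is in range, and [C, P_N] = 0. For j < N each contributes -(N -
   j)/2 times P_(j+1). *)
have [jltN|Nj] := ltnP j N; last first.
  have -> : j = N by lia.
  by rewrite subnn scale0r !add0r.
rewrite subnSK // subKn //.
by rewrite -!scalerDl -[RHS](scale0r (P j.+1 v)); congr (_ *: _); field.
Qed.

(** As for [Ct], with the special summands k = j - 1 and k = N - j, each contributing j/2 times
    P_(j-1). *)
Lemma HtP j v : (j <= N)%N -> Ht (P j v) = P j (Ht v).
Proof.
move=> jN; rewrite /Ht HP // linearD linear_sum /= -addrA; congr (_ + _).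
have PPP (k : 'I_N) : sug k *: P k (P (N - k.+1) (P j v)) =
    P j (sug k *: P k (P (N - k.+1) v)) +
    ((if (k + 1 == j)%N then (k.+1%:R / 2) *: P k v else 0) +
     (if (k + j == N)%N then ((N - k)%:R / 2) *: P (N - k.+1) v else 0)).
  have kN := ltn_ord k.
  rewrite [P _ (P j v)]PP linearD linearZ /= [P _ (P j _)]PP linearZ /=
    !scalerDr !scalerA -addrA.
  rewrite I_sym //.
  rewrite -[in RHS]sugI.
  have -> : (N - k.+1 + j == N)%N = (k + 1 == j)%N by apply/eqP/eqP; lia.
  have -> : k.+1%:R / 2 = sug k * (- I k.+1 * mu) by rewrite mulNr mulrN sugIS
    // opprK.
  congr (_ + _); rewrite addrC.
  by congr (_ + _); case: eqP => _; rewrite ?mulr0 ?scale0r.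
rewrite (eq_bigr _ (fun k _ => PPP k)) !big_split /= [LHS]addrCA -[RHS]addr0;
  congr (_ + _).
have /= -> := sum_ord_delta_rev N j (fun k => ((N - k)%:R / 2) *: P (N - k.+1) v).
rewrite jN /=.
(* At j = 0 neither special summand occurs, in agreement with [H, P_0] = 0. *)
case: j jN {PPP} => [|j] jN.
  rewrite big1 => [|k _]; last by rewrite addn1.
  by rewrite scale0r oppr0 !add0r.
under eq_bigr do rewrite addn1 eqSS.
have /= -> := sum_ord_delta N j (fun k => (k.+1%:R / 2) *: P k v).
rewrite jN /=.
rewrite subKn // subnSK // subKn ?(ltnW jN) //.
by rewrite -scaleNr -!scalerDl -[RHS](scale0r (P j v)); congr (_ *: _); field.
Qed.

(** [Ct] commutes with every P, hence with the correction in [Ht]. What remains is [Ct, H], computed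
    by moving H through the two factors of each summand. *)
Lemma CtHt v : Ct (Ht v) = Ht (Ct v) + Dt v.
Proof.
have -> : Ct (Ht v) = Ct (H v) + \sum_(k < N) sug k *: P k (P (N - k.+1) (Ct v)).
  rewrite /Ht linearD linear_sum; congr (_ + _); apply: eq_bigr => k _.
  by have kN := ltn_ord k; rewrite linearZ /= !CtP //; lia.
rewrite /Ht /Dt [RHS]addrAC; congr (_ + _).
rewrite /Ct /sug_form linearD linear_sum CH /= -!addrA; congr (_ + _).
rewrite [RHS]addrCA; congr (_ + _); rewrite -big_split; apply: eq_bigr => k _ /=.
have kN := ltn_ord k.
rewrite linearZ /= -scalerDr; congr (_ *: _).
rewrite HP // HP ?leq_subr // linearB linearZ /= -subnS.
by rewrite addrA !subrK.
Qed.

Lemma DtP j v : (j <= N)%N -> Dt (P j v) = P j (Dt v).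
Proof.
move=> jN; have e u : Dt u = Ct (Ht u) - Ht (Ct u) by rewrite CtHt addrC addKr.
by rewrite !e linearB /= HtP // !CtP // HtP.
Qed.

(** Likewise only [D, Ct] remains, and every summand of [Ct] has D-weight -2. *)
Lemma DtCt v : Dt (Ct v) = Ct (Dt v) - 2 *: Ct v.
Proof.
have -> : Ct (Dt v) = Ct (D v) + \sum_(k < N) sug k *:
  (k.+1%:R *: P k (P (N - k) (Ct v)) + (N - k)%:R *: P k.+1 (P (N - k.+1) (Ct
    v))).
  rewrite /Dt linearD linear_sum; congr (_ + _); apply: eq_bigr => k _.
  have kN := ltn_ord k.
  by rewrite linearZ linearD !linearZ /= !CtP //; lia.
rewrite /Dt [RHS]addrAC; congr (_ + _).
rewrite /Ct /sug_form linearD linear_sum DC /= scalerDr opprD [RHS]addrACA.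
congr (_ + _); rewrite scaler_sumr -sumrB; apply: eq_bigr => k _ /=.
have kN := ltn_ord k.
rewrite linearZ /= [2 *: _]scalerA [2 * _]mulrC -[(sug k * _) *: _]scalerA
  -scalerBr; congr (_ *: _).
rewrite DP // DP ?leq_subr // linearD linearZ /= -addrA -scalerDl -scaleNr.
congr (_ + _ *: _); rewrite natrB ?(ltnW kN) //; ring.
Qed.

Lemma PPv0 k : (k <= N)%N ->
  P k (P (N - k) v0) = (if (k <= n)%N then I k * mu else 0) *: v0.
Proof.
move=> kN; case: leqP => kn.
  by rewrite PP subnKC // eqxx Pv0 // linear0 add0r.
by rewrite Pv0 ?linear0 ?scale0r //; lia.
Qed.

Definition delta_sug : F := delta + n.+1%:R ^+ 2 / 2.

(* The two halves of a summand cancel unless k = n, where only the first one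
   survives. *)
Lemma Dt_v0 : Dt v0 = delta_sug *: v0.
Proof.
rewrite /Dt Dv0 scalerDl; congr (_ + _).
transitivity (\sum_(k < N) (if k == n :> nat then
    ((N - k)%:R * k.+1%:R / 2) *: v0 else 0)); last first.
  have /= -> := sum_ord_delta N n (fun k => ((N - k)%:R * k.+1%:R / 2) *: v0).
  have -> : (N - n = n.+1)%N by lia.
  by have -> : (n < N)%N by lia.
apply: eq_bigr => k _; have kN := ltn_ord k.
rewrite PPv0 ?(ltnW kN) // PPv0 // !scalerA -scalerDl scalerA mulrDr.
rewrite [sug k * (k.+1%:R * _)]mulrCA [sug k * ((N - k)%:R * _)]mulrCA.
case: (ltngtP k n) => kn; rewrite ?mulr0 ?addr0 ?scale0r //.
  rewrite sugI sugIS // [X in X *: _](_ : _ = 0) ?scale0r //.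
  by rewrite mulrN [_ * (k.+1%:R / 2)]mulrCA subrr.
by rewrite sugI mulrCA mulrA.
Qed.

(** The indices in each summand add up to N - 1 = 2 n, so the two factors commute and at least one
    of them kills v0. *)
Lemma Ht_v0 : Ht v0 = 0.
Proof.
rewrite /Ht Hv0 add0r big1 // => k _.
have [kn|nk] := leqP k n;
  last by rewrite [P (N - _) _]Pv0 ?linear0 ?scaler0 //; lia.
rewrite PP Pv0 // linear0 add0r; case: eqP; last by rewrite scale0r scaler0.
by have := ltn_ord k; lia.
Qed.

Lemma sug_form_Ct_iter a v : sug_form (iter a Ct v) = iter a Ct (sug_form v).
Proof.
elim: a => //= a <-; rewrite /sug_form linear_sum; apply: eq_bigr => k _.
by have kN := ltn_ord k; rewrite linearZ /= !CtP //; lia.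
Qed.

Lemma Ht_fock L k : Ht (fock L k) = 0.
Proof.
elim: L => [|j L IH] /=; first exact: Ht_v0.
elim: (k j) => //= c IHc; rewrite HtP ?IHc ?linear0 //.
by have := ltn_ord j; lia.
Qed.

Lemma Dt_fock L k : Dt (fock L k) = delta_sug *: fock L k.
Proof.
elim: L => [|j L IH] /=; first exact: Dt_v0.
elim: (k j) => //= c IHc; rewrite DtP ?IHc ?linearZ //.
by have := ltn_ord j; lia.
Qed.

Lemma Dt_iter L k a :
  Dt (iter a Ct (fock L k)) = (delta_sug - 2 * a%:R) *: iter a Ct (fock L k).
Proof.
elim: a => [|a IH] /=; first by rewrite mulr0 subr0 Dt_fock.
rewrite DtCt IH linearZ -scalerBl /=; congr (_ *: _).
by rewrite -[a.+1]addn1 natrD; ring.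
Qed.

(** The sl_2 coefficient: the sum of -(delta_sug - 2 i) over i <= a. *)
Definition ht_coef a : F := - (a.+1%:R * (delta_sug - a%:R)).

Lemma Ht_iter L k a :
  Ht (iter a.+1 Ct (fock L k)) = ht_coef a *: iter a Ct (fock L k).
Proof.
have HtCt v : Ht (Ct v) = Ct (Ht v) - Dt v by rewrite CtHt addrK.
elim: a => [|a IH].
  rewrite /= HtCt Ht_fock linear0 Dt_fock sub0r -scaleNr; congr (_ *: _).
  by rewrite /ht_coef subr0 mul1r.
rewrite iterS HtCt IH Dt_iter linearZ -scalerBl; congr (_ *: _).
by rewrite /ht_coef -[a.+2]addn1 -[a.+1]addn1 !natrD; ring.
Qed.

(** * Triangularity of the base change *)

Definition wvec (x : pbw n) : V := iter x.1 Ct (fock (enum 'I_n.+1) x.2).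

(** Linear combinations of the decoupled vectors of level m with fewer than h factors [Ct]. *)
Inductive lower_span (h m : nat) : V -> Prop :=
| LowerSpan0 : lower_span h m 0
| LowerSpanS c x u : (x.1 < h)%N -> level x = m -> lower_span h m u ->
    lower_span h m (c *: wvec x + u).

Lemma lower_spanD h m u v :
  lower_span h m u -> lower_span h m v -> lower_span h m (u + v).
Proof.
elim=> [|c x w xh xm _ IH] vs; first by rewrite add0r.
by rewrite -addrA; apply: LowerSpanS => //; exact: IH.
Qed.

Lemma lower_spanZ h m c u : lower_span h m u -> lower_span h m (c *: u).
Proof.
elim=> [|a x w xh xm _ IH]; first by rewrite scaler0; exact: LowerSpan0.
by rewrite scalerDr scalerA; exact: LowerSpanS.
Qed.

Lemma lower_span_wvec h m x : (x.1 < h)%N -> level x = m -> lower_span h m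
  (wvec x).
Proof.
move=> xh xm; rewrite -[wvec x]addr0 -[wvec x]scale1r.
by apply: LowerSpanS => //; exact: LowerSpan0.
Qed.

Lemma lower_span_linear (A : {linear V -> V}) h m h' m' u :
  (forall x, (x.1 < h)%N -> level x = m -> lower_span h' m' (A (wvec x))) ->
  lower_span h m u -> lower_span h' m' (A u).
Proof.
move=> Aw; elim=> [|c x w xh xm _ IH]; first by rewrite linear0;
  exact: LowerSpan0.
by rewrite linearD linearZ; apply: lower_spanD => //; apply/lower_spanZ/Aw.
Qed.

Lemma lower_span_iter_Ct a h m u :
  lower_span h m u -> lower_span (h + a) (m + 2 * a) (iter a Ct u).
Proof.
elim: a => [|a IH] us; first by rewrite muln0 !addn0.
rewrite iterS; apply: lower_span_linear (IH us) => -[b k] /= bh bm.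
rewrite -[Ct (wvec _)]/(wvec (b.+1, k)); apply: lower_span_wvec => /=; first lia.
by move: bm; rewrite /level /=; lia.
Qed.

(* In a summand of [sug_form] at most one of the two P's annihilates; the
   other then creates, so that the level increases by 2. *)
Lemma lower_span_PP (k : {ffun 'I_n.+1 -> nat}) i j : (i + j = N.+1)%N -> (0 <
  j <= n.+1)%N ->
  lower_span 1 (level (0%N, k)).+2 (P j (P i (fock (enum 'I_n.+1) k))).
Proof.
move=> ij /andP[j0 jn]; have ue := enum_uniq 'I_n.+1;
  have me a := mem_enum 'I_n.+1 a.
have wE l : fock (enum 'I_n.+1) l = wvec (0%N, l) by [].
(* As i + j = 2 n + 2 and j <= n + 1, the inner operator P_i creates; P_j creates only for j = n +
   1. *)
have i1 : (i - n.+1 < n.+1)%N by lia.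
have iE : i = (n.+1 + Ordinal i1)%N by rewrite /=; lia.
rewrite iE fock_raise ?me //.
have lr := level_upd 0 k (Ordinal i1) (k (Ordinal i1)).+1; rewrite /= in lr.
have [jE|jE] := eqVneq j n.+1.
  have -> : j = (n.+1 + (ord0 : 'I_n.+1))%N by rewrite addn0.
  rewrite fock_raise ?me // wE; apply: lower_span_wvec => //.
  set l := ffun_upd _ _ _ in lr *.
  have := level_upd 0 l ord0 (l ord0).+1; rewrite /= in lr *; lia.
have j1 : (n - j < n.+1)%N by lia.
have -> : j = (n - Ordinal j1)%N by rewrite /=; lia.
rewrite fock_lower ?me // wE; set l := ffun_upd _ _ _ in lr *.
case lj: (l (Ordinal j1)) => [|c].
  by rewrite mul0r scale0r; exact: LowerSpan0.
apply/lower_spanZ/lower_span_wvec => //.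
have := level_upd 0 l (Ordinal j1) c; rewrite lj /= in lr *; lia.
Qed.

Lemma lower_span_sug_form k :
  lower_span 1 (level (0%N, k)).+2 (sug_form (fock (enum 'I_n.+1) k)).
Proof.
rewrite /sug_form; elim/big_ind: _ => [|u v|i _]; first exact: LowerSpan0.
  exact: lower_spanD.
have iN := ltn_ord i; apply: lower_spanZ.
have [ni|ni] := leqP i n; first by apply: lower_span_PP; lia.
(* The indices add up to N + 1, so the factors commute and can be swapped to let the creation
   operator act first. *)
rewrite PP ifF ?scale0r ?addr0; last by apply/eqP; lia.
by apply: lower_span_PP; lia.
Qed.

Definition vvec (x : pbw n) : V := iter x.1 C (fock (enum 'I_n.+1) x.2).

(** Each C is Ct - sug_form. Since [sug_form] commutes with [Ct], using it instead of [Ct] gives a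
    vector of the same level with fewer factors [Ct]. *)
Lemma vvec_wvec x : exists2 u, vvec x = wvec x + u & lower_span x.1 (level x) u.
Proof.
have CCt v : C v = Ct v - sug_form v by rewrite /Ct addrK.
have lowerQ a k : lower_span a.+1 (level (a.+1, k)) (sug_form (wvec (a, k))).
  rewrite /wvec sug_form_Ct_iter.
  have -> : level (a.+1, k) = ((level (0, k)).+2 + 2 * a)%N by rewrite /level
    /=; lia.
  by rewrite -[a.+1]add1n; apply: lower_span_iter_Ct; exact: lower_span_sug_form.
case: x => h k; elim: h => [|h [u vE us]] /=.
  by exists 0; [rewrite addr0 | exact: LowerSpan0].
exists (C u - sug_form (wvec (h, k))).
  rewrite -[vvec (h.+1, k)]/(C (vvec (h, k))) vE linearD /= CCt.
  rewrite -[Ct (wvec _)]/(wvec (h.+1, k)).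
  by rewrite addrAC -addrA.
apply: lower_spanD; last by rewrite -scaleN1r; apply: lower_spanZ.
apply: lower_span_linear us => -[b l] /= bh bm; rewrite CCt.
have lE : level (b.+1, l) = level (h.+1, k) by move: bm; rewrite /level /=; lia.
apply: lower_spanD.
  by rewrite -[Ct (wvec _)]/(wvec (b.+1, l)); apply: lower_span_wvec.
rewrite -scaleN1r -lE; apply: lower_spanZ.
have := lowerQ b l; elim=> [|c x v xb xm _ IH]; first exact: LowerSpan0.
by apply: LowerSpanS => //; apply: leq_trans xb _; lia.
Qed.

Lemma lower_span_coef h m s u : level_enum m s -> lower_span h m u ->
  exists2 c : pbw n -> F,
    u = \sum_(y <- s) c y *: wvec y & forall y, (h <= y.1)%N -> c y = 0.
Proof.
move=> [us sE]; elim=> [|a x v xh xm _ [c vE c0]].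
  by exists (fun=> 0) => //; rewrite big1 // => y _; rewrite scale0r.
exists (fun y => (if y == x then a else 0) + c y) => [|y hy]; last first.
  by rewrite c0 // addr0; case: eqP => // yx; move: xh; rewrite -yx ltnNge hy.
under eq_bigr do rewrite scalerDl.
rewrite big_split /= -vE; congr (_ + _).
rewrite (bigD1_seq x) ?sE ?xm //= eqxx big1 ?addr0 // => y /negPf ->.
by rewrite scale0r.
Qed.

(** * Orthogonality of the decoupled basis *)

Section DecoupledForm.
Variable f : {bilinear V -> V -> F | *%R & Num.conj \; *%R}.
Hypothesis f_v0 : f v0 v0 = 1.
Hypothesis f_C : forall x y, f (C x) y = f x (H y).
Hypothesis f_H : forall x y, f (H x) y = f x (C y).
Hypothesis f_P : forall k x y, (k <= N)%N -> f (P k x) y = f x (P (N - k) y).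
Hypothesis mu_real : mu \is Num.real.
Hypothesis delta_real : delta \is Num.real.
Hypothesis I_real : forall k, I k \is Num.real.

Lemma sug_conj k : (sug k)^* = sug k.
Proof. by rewrite conj_Creal // /sug !(rpredM, rpredV) // realn. Qed.

(** The adjoint of summand k in the correction of C is summand k in that of H, as N - (k + 1) and N
    - (N - k) = k are its indices and [sug k] is real. *)
Lemma f_Ct x y : f (Ct x) y = f x (Ht y).
Proof.
rewrite /Ct /Ht /sug_form linearDl f_C linearD; congr (_ + _).
rewrite linear_sumlz linear_sum; apply: eq_bigr => k _; have kN := ltn_ord k.
rewrite /= linearZl_LR linearZr_LR /= sug_conj f_P // f_P ?leq_subr //.
by rewrite subKn // ltnW.
Qed.

Lemma f_Ht x y : f (Ht x) y = f x (Ct y).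
Proof.
rewrite /Ct /Ht /sug_form linearDl f_H linearD; congr (_ + _).
rewrite linear_sumlz linear_sum; apply: eq_bigr => k _; have kN := ltn_ord k.
rewrite /= linearZl_LR linearZr_LR /= sug_conj f_P ?(ltnW kN) // f_P ?leq_subr //.
by rewrite subKn.
Qed.

Definition wnorm (x : pbw n) : F :=
  (\prod_(i < x.1) ht_coef i) * \prod_(j < n.+1) fock_norm x.2 j.

(** The ladder argument for [Ct] and [Ht] on Fock states, which [Ht] kills, reduces this to
    orthogonality of the Fock states. *)
Lemma wvec_orthogonal x y : f (wvec x) (wvec y) = if x == y then wnorm x else 0.
Proof.
rewrite (@ladder_orthogonal _ _ f _ Ht ht_coef).
- rewrite (fock_orthogonal f_v0 f_P mu_real I_real) ?enum_uniq // big_enum.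
  case: x y => [a k] [b l] /=; rewrite xpair_eqE; case: eqP => //= _.
  have -> : all (fun j => k j == l j) (enum 'I_n.+1) = (k == l).
    apply/allP/eqP => [kl|-> //]; apply/ffunP => j; apply/eqP/kl.
    exact: mem_enum.
  by case: eqP; rewrite ?mulr0.
- exact: f_Ct.
- exact: f_Ht.
- move=> c; rewrite /ht_coef /delta_sug rpredN rpredM ?realn // rpredB ?realn //.
  by rewrite rpredD // rpredM ?rpredX ?rpredV ?realn.
- exact: Ht_fock.
- exact: Ht_fock.
- exact: Ht_iter.
Qed.

Lemma det_vvec m s : level_enum m s ->
  \det (\matrix_(i < size s, j < size s)
          f (vvec (tnth (in_tuple s) i)) (vvec (tnth (in_tuple s) j))) =
  \prod_(x <- s) wnorm x.
Proof.
move=> es; rewrite (det_gram_unitriangular (f := f) (r := fst) (w := wvec)).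
- by apply: eq_bigr => x _; rewrite wvec_orthogonal eqxx.
- by case: es.
- move=> x; case: (es) => _ -> /eqP xm; have [u -> us] := vvec_wvec x.
  by rewrite xm in us; have [c -> c0] := lower_span_coef es us; exists c.
- by move=> x y /negPf xy; rewrite wvec_orthogonal xy.
Qed.

End DecoupledForm.

End Decoupling.

End OscillatorModule.

(** * Verma modules *)

Local Open Scope complex_scope.

Section VermaModule.
Variables (R : realType) (n : nat).
Local Notation N := n.*2.+1.

Lemma bracket_egen (a b : gen n) : bracket (egen R a) (egen R b) = bracket_gen
  R a b.
Proof.
rewrite /bracket (bigD1 a) //= (bigD1 b) //= !ffunE !eqxx mulr1 scale1r.
rewrite !big1 ?addr0 // => [c ca|c cb].
  by rewrite big1 // => d _; rewrite ffunE (negPf ca) mul0r scale0r.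
by rewrite !ffunE (negPf cb) mulr0 scale0r.
Qed.

Lemma eP_ord (k : nat) (kN : (k < n.*2.+2)%N) : eP R n k = egen R (gP (Ordinal
  kN)).
Proof. by rewrite /eP insubT. Qed.

Lemma eP_out (k : nat) : (N < k)%N -> eP R n k = 0.
Proof. by move=> Nk; rewrite /eP insubF // ltnNge Nk. Qed.

Lemma two_ell : 2 * ell R n = N%:R.
Proof.
by rewrite /ell -[n.*2.+1]addn1 -muln2 natrD natrM; field.
Qed.

Definition Icx (k : nat) : R[i] := (Icoef R n k)%:C.

Lemma Icx_neq0 k : Icx k != 0.
Proof.
rewrite fmorph_eq0 /Icoef mulf_neq0 ?signr_eq0 // pnatr_eq0 -lt0n muln_gt0.
by rewrite !fact_gt0.
Qed.

Lemma Icx_real k : Icx k \is Num.real.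
Proof. exact/complex_realP/ex_intro. Qed.

Lemma Icx_rec k : (k < N)%N -> Icx k.+1 * (N - k)%:R = - (k.+1%:R * Icx k).
Proof.
move=> kN; rewrite -!(rmorph_nat (real_complex R)) -!rmorphM -rmorphN;
  congr (_%:C).
have fE : ((k.+1)`! * (N - k.+1)`! * (N - k) = k.+1 * (k`! * (N - k)`!))%N.
  by rewrite -[in RHS](subnSK kN) !factS subnSK //; ring.
rewrite /Icoef addSn exprS mulN1r !mulNr; congr (- _).
by rewrite -mulrA -natrM fE natrM mulrCA.
Qed.

(** The factorials are symmetric, while k and N - k have opposite parity because N is odd. *)
Lemma Icx_sym k : (k <= N)%N -> Icx (N - k) = - Icx k.
Proof.
move=> kN; rewrite /Icx -rmorphN /Icoef subKn // mulnC -mulNr; congr ((_ * _)%:C).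
rewrite -signr_odd -[in RHS]signr_odd !oddD oddB // /= odd_double.
by case: odd; case: odd; rewrite /= ?expr0 ?expr1 ?opprK.
Qed.

(** The index of P_(ell+1/2)^m v0; each factor has level 1. *)
Definition pbw_ord0 (m : nat) : pbw n := (0%N, [ffun j => if j == ord0 then m
  else 0%N]).

Lemma level_pbw_ord0 m : level (pbw_ord0 m) = m.
Proof.
rewrite /level /= (bigD1 ord0) //= ffunE eqxx muln0 add0n mul1n big1 ?addn0 //.
by move=> j /negPf j0; rewrite ffunE j0 muln0.
Qed.

Variables (V : lmodType R[i]) (act : {bilinear cga R n -> V -> V}) (v0 : V).
Variables (delta mu : R).
Hypothesis verma : is_verma act v0 delta mu.

Lemma act_comm a b v : act (egen R a) (act (egen R b) v) =
  act (egen R b) (act (egen R a) v) + act (bracket_gen R a b) v.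
Proof. by rewrite -bracket_egen (verma_bracket verma) addrC subrK. Qed.

(** M is central, so its eigenvalue on v0 carries over to all PBW vectors, which span V. *)
Lemma act_M v : act (egen R gM) v = mu%:C *: v.
Proof.
have [s [c ->]] := verma_span verma v.
rewrite linear_sum scaler_sumr; apply: eq_bigr => x _ /=.
rewrite linearZ /= scalerA mulrC -scalerA; congr (_ *: _).
have comm a w : act (egen R gM) w = mu%:C *: w ->
    act (egen R gM) (act (egen R a) w) = mu%:C *: act (egen R a) w.
  by move=> wE; rewrite act_comm wE linearZ /=; case: a => *;
    rewrite linear0l addr0.
rewrite /pbw_vec; elim: x.1 => [|h IH] /=; last exact: comm.
elim: (enum 'I_n.+1) => [|j L IH] /=; first exact: verma_M verma.
elim: (x.2 j) => //= k IHk.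
have jN : (n.+1 + j < n.*2.+2)%N by have := ltn_ord j; lia.
by have := comm (gP (Ordinal jN)) _ IHk; rewrite -eP_ord.
Qed.

Local Notation P := (fun k => act (eP R n k) : {linear V -> V}).

Lemma verma_CP k v : (k <= N)%N -> act (egen R gC) (act (eP R n k) v) =
  act (eP R n k) (act (egen R gC) v) + (N - k)%:R *: act (eP R n k.+1) v.
Proof.
move=> kN; rewrite (eP_ord kN) act_comm /= linearZl_LR two_ell;
  congr (_ + _ *: _).
by rewrite -natrB // (rmorph_nat (real_complex R)).
Qed.

Lemma verma_HP k v : (k <= N)%N -> act (egen R gH) (act (eP R n k) v) =
  act (eP R n k) (act (egen R gH) v) - k%:R *: act (eP R n k.-1) v.
Proof.
move=> kN; rewrite (eP_ord kN) act_comm /= linearZl_LR -scaleNr;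
  congr (_ + _ *: _).
by rewrite rmorphN (rmorph_nat (real_complex R)).
Qed.

Lemma verma_DP k v : (k <= N)%N -> act (egen R gD) (act (eP R n k) v) =
  act (eP R n k) (act (egen R gD) v) + (N%:R - 2 * k%:R) *: act (eP R n k) v.
Proof.
move=> kN; rewrite [in LHS](eP_ord kN) act_comm /= linearZl_LR mulrBr two_ell.
by rewrite -(eP_ord kN) rmorphB rmorphM !(rmorph_nat (real_complex R)).
Qed.

Lemma verma_PP a b v : act (eP R n a) (act (eP R n b) v) =
  act (eP R n b) (act (eP R n a) v) +
  (if (a + b == N)%N then Icx a * mu%:C else 0) *: v.
Proof.
(* Outside the range [eP] is 0, and then a + b = N is impossible. *)
case: (leqP a N) => [aN|Na]; last first.
  by rewrite (eP_out Na) !linear0l linear0 add0r ifF ?scale0r //; lia.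
case: (leqP b N) => [bN|Nb]; last first.
  by rewrite (eP_out Nb) !linear0l linear0 add0r ifF ?scale0r //; lia.
rewrite (eP_ord aN) (eP_ord bN) act_comm /=; congr (_ + _).
case: eqP => _; last by rewrite linear0l scale0r.
by rewrite linearZl_LR act_M scalerA.
Qed.

Lemma verma_CH v : act (egen R gC) (act (egen R gH) v) =
  act (egen R gH) (act (egen R gC) v) + act (egen R gD) v.
Proof. by rewrite act_comm. Qed.

Lemma verma_DC v : act (egen R gD) (act (egen R gC) v) =
  act (egen R gC) (act (egen R gD) v) - 2 *: act (egen R gC) v.
Proof.
by rewrite act_comm /= linearZl_LR -scaleNr rmorphN (rmorph_nat (real_complex R)).
Qed.

(** * The Kac determinant of a Verma module *)

Variable f : sesqform V.
Hypothesis shap : is_shapovalov act v0 f.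

Lemma shapovalov_P k x y : (k <= N)%N ->
  f (act (eP R n k) x) y = f x (act (eP R n (N - k)) y).
Proof.
move=> kN; rewrite (eP_ord kN) (shapovalov_contra shap) /=; congr (f x (act _ y)).
have NkN : (N - k < n.*2.+2)%N by rewrite ltnS leq_subr.
by rewrite (eP_ord NkN); congr (egen R (gP _)); apply: val_inj; rewrite /= subSS.
Qed.

Lemma pbw_vecE x :
  pbw_vec act v0 x = vvec (act (egen R gC) : {linear V -> V}) P v0 x.
Proof. by []. Qed.

(** The part of [wnorm] free of delta and mu. The halves compensate for [kac_factor i] being twice
    delta_sug - i. *)
Definition pbw_const (x : pbw n) : R[i] :=
  (\prod_(i < x.1) (- (i.+1%:R / 2))) *
  \prod_(j < n.+1) \prod_(i < x.2 j) (i.+1%:R * Icx (n - j)).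

Definition kac_factor (i : nat) : R[i] :=
  (2 * delta - 2 * i%:R + (ell R n + 2^-1) ^+ 2)%:C.

Lemma wnormE x : wnorm Icx delta%:C mu%:C x =
  pbw_const x * mu%:C ^+ (\sum_(j < n.+1) x.2 j) * \prod_(i < x.1) kac_factor i.
Proof.
rewrite /wnorm /pbw_const.
have -> : \prod_(i < x.1) ht_coef n delta%:C i =
    (\prod_(i < x.1) (- (i.+1%:R / 2))) * \prod_(i < x.1) kac_factor i.
  rewrite -big_split; apply: eq_bigr => i _.
  have eE : ell R n + 2^-1 = n.+1%:R.
    by rewrite /ell -[n.+1]addn1 natrD; field.
  rewrite /ht_coef /delta_sug /kac_factor eE /=.
  by rewrite rmorphD rmorphB rmorphXn !rmorphM !(rmorph_nat (real_complex R));
    field.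
have -> : \prod_(j < n.+1) fock_norm Icx mu%:C x.2 j =
    (\prod_(j < n.+1) \prod_(i < x.2 j) (i.+1%:R * Icx (n - j))) *
    mu%:C ^+ (\sum_(j < n.+1) x.2 j).
  rewrite -prodrXr -big_split; apply: eq_bigr => j _.
  rewrite /fock_norm -[X in mu%:C ^+ X]card_ord -prodr_const -big_split.
  by apply: eq_bigr => i _ /=; rewrite mulrA.
by rewrite mulrACA [X in _ * X]mulrC mulrA.
Qed.

Lemma prod_wnorm m s : level_enum m s ->
  \prod_(x <- s) wnorm Icx delta%:C mu%:C x =
  (\prod_(x <- s) pbw_const x) * mu%:C ^+ kac_e n m *
  \prod_(0 <= j < m./2) kac_factor j ^+ kac_d n (m - 2 * (j + 1))%N.
Proof.
move=> es; under eq_bigr do rewrite wnormE.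
rewrite !big_split /= prodrXr (level_enum_e es); congr (_ * _).
(* The range i < x.1 is widened to the common range i < m./2, so that the products can be
   exchanged. *)
transitivity (\prod_(x <- s) \prod_(0 <= j < m./2 | (j < x.1)%N) kac_factor j).
  apply: eq_big_seq => x xs; rewrite -(big_mkord xpredT kac_factor).
  by rewrite (big_nat_widen _ _ _ _ _ (pbw1_le_half es xs)).
rewrite (exchange_big_dep xpredT) //= big_nat [RHS]big_nat.
apply: eq_bigr => j /andP[_ jm].
by rewrite big_const_seq iter_mulr_1 (count_pbw1_gt es jm).
Qed.

Lemma real_complex_real (a : R) : a%:C \is Num.real.
Proof. exact/complex_realP/ex_intro. Qed.

Lemma shapovalov_C x y : f (act (egen R gC) x) y = f x (act (egen R gH) y).
Proof. exact: (shapovalov_contra shap). Qed.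

Lemma shapovalov_H x y : f (act (egen R gH) x) y = f x (act (egen R gC) y).
Proof. exact: (shapovalov_contra shap). Qed.

Lemma kac_det_mu_neq0 m s : mu != 0 -> level_enum m s ->
  kac_det act v0 f s = \prod_(x <- s) wnorm Icx delta%:C mu%:C x.
Proof.
move=> mu0 es; have mu0c : mu%:C != 0 by rewrite fmorph_eq0.
exact: (det_vvec (C := act (egen R gC)) (H := act (egen R gH))
  (D := act (egen R gD)) (P := P) Icx_neq0 Icx_rec Icx_sym verma_CP verma_HP
  verma_DP verma_PP verma_CH verma_DC (verma_H verma) (verma_D verma)
  (verma_P verma) mu0c (shapovalov_norm shap) shapovalov_C shapovalov_H
  shapovalov_P (real_complex_real mu) (real_complex_real delta) Icx_real es).
Qed.

(** The Gram matrix has a zero column, that of P_(ell+1/2)^m v0. *)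
Lemma kac_det_mu_eq0 m s : mu = 0 -> (0 < m)%N -> level_enum m s ->
  kac_det act v0 f s = 0.
Proof.
move=> mu0 m0 [us sE].
set x0 := pbw_ord0 m; have x0s : x0 \in s by rewrite sE level_pbw_ord0.
have is0 : (index x0 s < size s)%N by rewrite index_mem.
rewrite /kac_det (expand_det_col _ (Ordinal is0)) big1 // => i _.
rewrite mxE [tnth _ (Ordinal _)](tnth_nth x0) /= nth_index // [pbw_vec _ _
  x0]pbw_vecE.
rewrite (fock_radical (C := act (egen R gC)) (H := act (egen R gH)) (P := P)
  verma_HP verma_PP (verma_H verma) (verma_P verma) (shapovalov_norm shap)
  shapovalov_C shapovalov_P (real_complex_real mu) Icx_real) ?mul0r //.
by rewrite mu0.
Qed.

(** The basis is v0 alone, so the identity holds for mu = 0 too, where [sug] divides by zero. *)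
Lemma kac_det_level0 s : level_enum 0 s ->
  kac_det act v0 f s = \prod_(x <- s) wnorm Icx delta%:C mu%:C x.
Proof.
move=> es; pose x0 : pbw n := (0%N, [ffun=> 0%N]).
have e0 : level_enum 0 [:: x0].
  split=> // -[h k]; rewrite inE xpair_eqE /level addn_eq0 muln_eq0 /=
    sum_nat_eq0.
  congr (_ && _); apply/eqP/forallP => [-> j|k0]; first by rewrite ffunE muln0.
  by apply/ffunP => j; have := k0 j;
    rewrite ffunE muln_eq0 addn_eq0 andbF => /eqP.
have -> : s = [:: x0] by apply: perm_small_eq => //; exact: level_enum_perm es e0.
rewrite /kac_det det_mx11 mxE big_seq1 !(tnth_nth x0) /= [pbw_vec _ _ _]pbw_vecE.
rewrite [LHS](fock_orthogonal (P := P) verma_PP (verma_P verma)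
  (shapovalov_norm shap)
  shapovalov_P (real_complex_real mu) Icx_real) ?enum_uniq //.
rewrite ifT; last by apply/allP.
by rewrite big_enum /wnorm big_ord0 mul1r.
Qed.

End VermaModule.

Theorem theorem13 (R : realType) (n m : nat) :
  exists K : R[i],
    forall (delta mu : R) (V : lmodType R[i])
           (act : {bilinear cga R n -> V -> V}) (v0 : V) (f : sesqform V)
           (s : seq (pbw n)),
      is_verma act v0 delta mu ->
      is_shapovalov act v0 f ->
      level_enum m s ->
      kac_det act v0 f s =
        K * mu%:C ^+ kac_e n m *
        \prod_(0 <= j < m./2)
          (2 * delta - 2 * j%:R + (ell R n + 2^-1) ^+ 2)%:C
            ^+ kac_d n (m - 2 * (j + 1))%N.
Proof.
have [s0 es0] := level_enum_ex n m.
(* The constant does not depend on the order in which the level is listed, so a fixed enumeration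
   [s0] is used. *)
exists (\prod_(x <- s0) pbw_const R x) => delta mu V act v0 f s verma shap es.
have -> : \prod_(x <- s0) pbw_const R x = \prod_(x <- s) pbw_const R x.
  by apply: perm_big; exact: level_enum_perm es0 es.
rewrite -/(kac_factor _ _ _) -(prod_wnorm delta mu es).
have [mu0|mu0] := eqVneq mu 0; last exact: (kac_det_mu_neq0 verma shap mu0 es).
case: m es {s0 es0} => [|m] es; first exact: (kac_det_level0 verma shap).
rewrite (kac_det_mu_eq0 verma shap mu0 _ es) // (prod_wnorm delta mu es) mu0.
have x0s : pbw_ord0 n m.+1 \in s by case: es => _ ->; rewrite level_pbw_ord0.
(* The exponent of mu must be positive, as 0^0 = 1; P_(ell+1/2)^(m+1) contributes to it. *)
rewrite expr0n; have -> : (kac_e n m.+1 == 0)%N = false;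
  last by rewrite mulr0 mul0r.
rewrite -(level_enum_e es) (bigD1_seq (pbw_ord0 n m.+1)) //=; last by case: es.
by rewrite (bigD1 ord0) //= ffunE eqxx.
Qed.
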